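(* Let $(M,d)$ be a Polish space, let $\mu,\upsilon\in\mathcal{P}(M)$ be Borel probability measures on $M$, and let $(\mathcal{A}_m,M_m)_{m\in\mathbb{N}}$ be a sequence of tagged partitions adapted to $\mu$ (as defined in the context), with associated discretized measures $\mu^m,\upsilon^m$. Then $$\sup_m H(\upsilon^m|\mu^m)=\lim_{m\to\infty}H(\upsilon^m|\mu^m)=H(\upsilon|\mu).$$ Furthermore, if $\sup_m H(\upsilon^m|\mu^m)<\infty$, then there exists a constant $c\ge 0$ such that $d_{\rm BL}(\upsilon^m,\upsilon)\le \frac{c}{m}$ for all $m\in\mathbb{N}$.
   Context: $\mathbb{N}=\{1,2,\dots\}$. Relative entropy: $H(\upsilon|\mu)=\sup\{\int f\,d\upsilon-\log\int e^f\,d\mu:\ f \text{ measurable and bounded}\}\in[0,\infty]$. Bounded Lipschitz metric: $d_{\rm BL}(\mu,\upsilon)=\sup|\int f\,d\upsilon-\int f\,d\mu|$ over 1-Lipschitz $f:M\to\mathbb{R}$ with $|f|\le1$. Tagged partitions adapted to $\mu$: for each $m\in\mathbb{N}$ fix a compact set $K_m\subset M$ with $\mu(K_m^{\complement})\le \frac{e^{-m^2-1}}{m}$; it is assumed that $M=\overline{\bigcup_{m\ge1}K_m}$. Let $(\mathcal{A}_m)_{m\in\mathbb{N}}$ be a nested sequence ($\mathcal{A}_{m+1}$ refines $\mathcal{A}_m$) of finite partitions of $M$ into nonempty Borel sets, $\mathcal{A}_m=\{A_{m,1},\dots,A_{m,\ell_m}\}$, such that for some $\tilde\ell_m\le\ell_m$: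 $\mathrm{diam}(A_{m,i})<\frac1m$ for $i\le\tilde\ell_m$; $K_m^{\complement}=\bigcup_{i=\tilde\ell_m+1}^{\ell_m}A_{m,i}$; and the $\sigma$-algebra generated by $\bigcup_m\mathcal{A}_m$ is the Borel $\sigma$-algebra of $M$. Let $M_m=\{a_{m,1},\dots,a_{m,\ell_m}\}$ with $a_{m,i}\in A_{m,i}$ and $M_m\subset M_{m+1}$ for all $m$. Define $\pi^m:M\to M_m$ by $\pi^m(x)=a_{m,i}$ if $x\in A_{m,i}$. For $\upsilon\in\mathcal{P}(M)$, $\upsilon^m\in\mathcal{P}(M)$ is the pushforward of $\upsilon$ under $\pi^m$, i.e. $\upsilon^m(\{a_{m,i}\})=\upsilon(A_{m,i})$. *)

(* Defs.v *)
From HB Require Import structures.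
From mathcomp Require Import all_boot all_order all_algebra.
From mathcomp Require Import all_classical all_reals all_analysis.

Set Implicit Arguments.
Unset Strict Implicit.
Unset Printing Implicit Defensive.

Import Order.TTheory GRing.Theory Num.Theory.
Import numFieldTopology.Exports numFieldNormedType.Exports.

Local Open Scope classical_set_scope.
Local Open Scope ring_scope.

(* A pointed, hence nonempty, complete metric space. No generality is lost: a
   space carrying a probability measure is nonempty. *)
#[short(type="completeMetricType")]
HB.structure Definition CompleteMetric (R : realType) :=
  {M of CompletePseudoMetric R M & Metric R M}.

Definition separable (T : topologicalType) : Prop :=
  exists2 D : set T, countable D & dense D.

Notation borel M := (g_sigma_algebraType (@open M)).

Definition diam {R : realType} {M : metricType R} (A : set M) : \bar R :=
  ereal_sup [set (mdist p.1 p.2)%:E | p in A `*` A].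

(* For bounded measurable f both integrals are finite, so that the real-valued
   integral and the total function ln lose nothing. *)
Definition relative_entropy {d} {T : measurableType d} {R : realType}
    (nu mu : probability T R) : \bar R :=
  ereal_sup [set (\int[nu]_x f x - ln (\int[mu]_x expR (f x)))%:E
            | f in [set f : T -> R | measurable_fun setT f /\ bounded_fun f]].

(* The test functions are continuous, hence Borel measurable. *)
Definition bounded_lipschitz_dist {R : realType} {M : completeMetricType R}
    (mu nu : probability (borel M) R) : \bar R :=
  ereal_sup [set `|\int[nu]_x f x - \int[mu]_x f x|%:E
            | f in [set f : M -> R | (forall x y, `|f x - f y| <= mdist x y) /\
                                     (forall x, `|f x| <= 1)]].

Unset Implicit Arguments.

(* Everything is indexed by n = m - 1, so that n ranges over all of nat when m
   ranges over the positive integers. Likewise the ordinal i : 'I_(tp_len n)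
   stands for the index i + 1, and "i <= tp_len_small" becomes a strict
   inequality. *)
Record tagged_partitions {R : realType} {M : completeMetricType R}
    (mu : probability (borel M) R) := TaggedPartitions {
  tp_K : nat -> set M ;
  tp_len : nat -> nat ;
  tp_len_small : nat -> nat ;
  tp_block : forall n, 'I_(tp_len n) -> set M ;
  tp_tag : forall n, 'I_(tp_len n) -> M ;

  tp_K_compact : forall n, compact (tp_K n) ;
  tp_K_measure : forall n,
    (mu (~` tp_K n) <= (expR (- n.+1%:R ^+ 2 - 1) / n.+1%:R)%:E)%E ;
  tp_K_dense : closure (\bigcup_n tp_K n) = [set: M] ;

  tp_block_partition : forall n, partition setT (tp_block n) [set: M] ;
  tp_block_measurable : forall n i,
    measurable (tp_block n i : set (borel M)) ;
  tp_block_refine : forall n (j : 'I_(tp_len n.+1)),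
    exists i : 'I_(tp_len n), tp_block n.+1 j `<=` tp_block n i ;
  tp_len_small_le : forall n, (tp_len_small n <= tp_len n)%N ;
  tp_block_diam : forall n (i : 'I_(tp_len n)),
    (i < tp_len_small n)%N -> (diam (tp_block n i) < (n.+1%:R^-1)%:E)%E ;
  tp_block_large : forall n,
    ~` tp_K n =
      \bigcup_(i in [set i : 'I_(tp_len n) | (tp_len_small n <= i)%N])
        tp_block n i ;
  tp_block_generate :
    <<s \bigcup_n range (tp_block n) >> = <<s @open M >> ;

  tp_tag_in : forall n i, tp_block n i (tp_tag n i) ;
  tp_tag_nested : forall n, range (tp_tag n) `<=` range (tp_tag n.+1)
}.

Set Implicit Arguments.

Arguments tp_K {R M mu}.
Arguments tp_len {R M mu}.
Arguments tp_len_small {R M mu}.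
Arguments tp_block {R M mu}.
Arguments tp_tag {R M mu}.
Arguments tp_block_partition {R M mu}.
Arguments tp_block_measurable {R M mu}.

Section discretization.
Context {R : realType} {M : completeMetricType R}
  {mu : probability (borel M) R} (P : tagged_partitions mu).

(* The default value is never taken: see tp_projE and tp_block_partition. *)
Definition tp_proj (n : nat) (x : borel M) : borel M :=
  oapp (tp_tag P n) point [pick i | `[< tp_block P n i x >]].

Lemma tp_projE n (i : 'I_(tp_len P n)) (x : M) :
  tp_block P n i x -> tp_proj n x = tp_tag P n i.
Proof.
move=> ix; rewrite /tp_proj; case: pickP => [j /asboolP jx|/(_ i)/asboolP//].
have [_ tI _] := tp_block_partition P n.
by rewrite (tI i j)//; exists x.
Qed.

Lemma measurable_tp_proj n : measurable_fun setT (tp_proj n).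
Proof.
move=> _ B mB; rewrite setTI.
have [cov _ _] := tp_block_partition P n.
suff -> : tp_proj n @^-1` B =
    \bigcup_(i in [set i | B (tp_tag P n i)]) tp_block P n i.
  by apply: fin_bigcup_measurable => // i _; exact: tp_block_measurable.
apply/seteqP; split => [x Bx|x [i Bi ix]]; last by rewrite /= (tp_projE ix).
have [i _ ix] : cover setT (tp_block P n) x by rewrite cov.
by exists i => //=; rewrite -(tp_projE ix).
Qed.

HB.instance Definition _ n :=
  isMeasurableFun.Build _ _ _ _ (tp_proj n) (measurable_tp_proj n).

Definition discretize (n : nat) (nu : probability (borel M) R) :
    probability (borel M) R :=
  distribution nu (tp_proj n).

End discretization.

(* Main.v *)
(** The projections satisfy pi^n o pi^m = pi^n for n <= m and their preimages
    generate the Borel sets.  Pulling test functions back along pi^n shows that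
    H(nu^n | mu^n) is nondecreasing in n and at most H(nu | mu).  Conversely,
    functions of the form g o pi^n are dense in L1(mu) and L1(nu) among bounded
    measurable functions (Dynkin's lemma for indicators, then staircase
    functions), and the functional f |-> nu f - ln (mu (exp f)) is L1-Lipschitz
    on uniformly bounded functions, so the discretized entropies exhaust
    H(nu | mu).  For the metric estimate, testing the entropy with m 1_A,
    A = K_m^c, gives m nu(A) <= H(nu | mu) + ln 2 because e^m mu(A) <= 1; and
    pi^m moves points of K_m by less than 1/m. *)

Require Import Defs.
From HB Require Import structures.
From mathcomp Require Import all_boot all_order all_algebra.
From mathcomp Require Import all_classical all_reals all_analysis.
From mathcomp Require Import measurable_realfun lra.

Import Order.TTheory GRing.Theory Num.Theory.
Import numFieldTopology.Exports numFieldNormedType.Exports.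

Local Open Scope classical_set_scope.
Local Open Scope ring_scope.

(** * Bounded measurable functions and their integrals *)

Definition bounded_measurable {d} {T : measurableType d} {R : realType}
    (f : T -> R) : Prop :=
  measurable_fun setT f /\ exists C, forall x, `|f x| <= C.

(** Translates between the test functions of [relative_entropy] and the form with one explicit bound
    [C], on which the estimates below depend. *)
Lemma bounded_measurableP {d} {T : measurableType d} {R : realType}
    (f : T -> R) :
  bounded_measurable f <-> measurable_fun setT f /\ bounded_fun f.
Proof.
split=> -[mf bf]; split => //.
- case: bf => C fC; exists C; split; first exact: num_real.
  by move=> D CD x _; apply: le_trans (ltW CD); exact: fC.
(* [bounded_fun] yields bounds only strictly above its threshold, hence [C + 1]. *)
- case: bf => C [_ fC]; exists (C + 1) => x.
  by apply: fC => //; rewrite ltrDl.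
Qed.

Section bounded_measurable_theory.
Context {d} {T : measurableType d} {R : realType}.
Implicit Types f g : T -> R.

Lemma bounded_measurable_cst (c : R) :
  bounded_measurable (fun _ : T => c).
Proof. by split; [exact: measurable_cst|exists `|c|]. Qed.

Lemma bounded_measurableD f g :
  bounded_measurable f -> bounded_measurable g ->
  bounded_measurable (fun x => f x + g x).
Proof.
move=> [mf [C fC]] [mg [D gD]]; split; first exact: measurable_funD.
by exists (C + D) => x; rewrite (le_trans (ler_normD _ _))// lerD.
Qed.

Lemma bounded_measurableZ (c : R) f :
  bounded_measurable f -> bounded_measurable (fun x => c * f x).
Proof.
move=> [mf [C fC]]; split; first exact: measurable_funM.
by exists (`|c| * C) => x; rewrite normrM ler_wpM2l.
Qed.

Lemma bounded_measurableB f g :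
  bounded_measurable f -> bounded_measurable g ->
  bounded_measurable (fun x => f x - g x).
Proof.
move=> [mf [C fC]] [mg [D gD]]; split; first exact: measurable_funB.
by exists (C + D) => x; rewrite (le_trans (ler_normB _ _))// lerD.
Qed.

Lemma bounded_measurable_norm f :
  bounded_measurable f -> bounded_measurable (fun x => `|f x|).
Proof.
move=> [mf [C fC]]; split; first exact: measurableT_comp.
by exists C => x; rewrite normr_id.
Qed.

Lemma bounded_measurable_expR f :
  bounded_measurable f -> bounded_measurable (fun x => expR (f x)).
Proof.
move=> [mf [C fC]]; split.
  by apply: measurableT_comp => //; exact: measurable_expR.
exists (expR C) => x; rewrite ger0_norm ?expR_ge0// ler_expR.
by rewrite (le_trans (ler_norm _)).
Qed.

Lemma bounded_measurable_indic (A : set T) :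
  measurable A -> bounded_measurable (\1_A : T -> R).
Proof.
move=> mA; split; first exact: measurable_indic.
by exists 1 => x; rewrite indicE; case: (x \in A); rewrite ?normr1 ?normr0.
Qed.

Lemma bounded_measurable_comp {d'} {U : measurableType d'} (p : {mfun U >-> T})
    f :
  bounded_measurable f -> bounded_measurable (fun x => f (p x)).
Proof.
move=> [mf [C fC]]; split; last by exists C.
exact: measurableT_comp.
Qed.

Lemma bounded_measurable_integrable (P : probability T R) f :
  bounded_measurable f -> P.-integrable setT (EFin \o f).
Proof.
move=> /bounded_measurableP[mf bf]; apply: measurable_bounded_integrable => //.
by rewrite [X in (X < _)%E]probability_setT ltry.
Qed.

Lemma Rintegral_probability_cst (P : probability T R) (c : R) :
  \int[P]_x c = c.
Proof. by rewrite Rintegral_cst// [X in fine X]probability_setT mulr1. Qed.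

Lemma Rintegral_probability_indic (P : probability T R) (A : set T) :
  measurable A -> \int[P]_x (\1_A x : R) = fine (P A).
Proof. by move=> mA; rewrite /Rintegral integral_indic// setIT. Qed.

End bounded_measurable_theory.

Lemma Rintegral_distribution {d d'} {T : measurableType d}
    {U : measurableType d'} {R : realType}
    (P : probability U R) (p : {mfun U >-> T}) (f : T -> R) :
  bounded_measurable f ->
  \int[distribution P p]_x f x = \int[P]_x f (p x).
Proof.
move=> bf; rewrite /Rintegral integral_distribution//.
  by apply/measurable_EFinP; case: bf.
exact/bounded_measurable_integrable/bounded_measurable_comp.
Qed.

(** * The entropy functional and elementary inequalities for ln and exp *)

Definition entropy_functional {d} {T : measurableType d} {R : realType}
    (mu nu : probability T R) (f : T -> R) : R :=
  \int[nu]_x f x - ln (\int[mu]_x expR (f x)).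

Lemma ln_le_subr1 {R : realType} (x : R) : 0 < x -> ln x <= x - 1.
Proof.
by move=> x0; have := @le_ln1Dx R (x - 1); rewrite subrKC; apply; lra.
Qed.

Lemma ln_sub_le {R : realType} (x y : R) :
  0 < x -> 0 < y -> ln x - ln y <= (x - y) / y.
Proof.
move=> x0 y0; rewrite -ln_div ?posrE// mulrBl divff ?gt_eqF//.
by rewrite ln_le_subr1// divr_gt0.
Qed.

(** Factor out [expR a] and use the tangent line bound [1 + (b - a) <= expR (b - a)]. *)
Lemma expR_sub_le {R : realType} (a b : R) :
  expR a - expR b <= expR a * `|a - b|.
Proof.
have -> : expR b = expR a * expR (b - a) by rewrite -expRD subrKC.
rewrite -[X in X - _]mulr1 -mulrBr ler_wpM2l ?expR_ge0//.
by have := expR_ge1Dx (b - a); have := ler_norm (a - b); lra.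
Qed.

(** * Continuity of the entropy functional in L1 *)

Section L1.
Context {d} {T : measurableType d} {R : realType} (mu nu : probability T R).
Implicit Types f g h : T -> R.

(** The two norms are added because the functional sees [nu] in its linear term and [mu] in its
    logarithmic term, so one approximant must be good for both measures. *)
Definition L1 f : R := \int[mu]_x `|f x| + \int[nu]_x `|f x|.

Lemma L1_le f g h : bounded_measurable f -> bounded_measurable g ->
  bounded_measurable h -> (forall x, `|f x| <= `|g x| + `|h x|) ->
  L1 f <= L1 g + L1 h.
Proof.
move=> /bounded_measurable_norm bf /bounded_measurable_norm bg.
move=> /bounded_measurable_norm bh fgh.
have le (P : probability T R) :
    \int[P]_x `|f x| <= \int[P]_x `|g x| + \int[P]_x `|h x|.
  rewrite -RintegralD//; [|exact: bounded_measurable_integrable..].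
  apply: le_Rintegral => //; apply: bounded_measurable_integrable => //.
  exact: bounded_measurableD.
by rewrite /L1 addrACA lerD.
Qed.

Lemma L1_cst (c : R) : L1 (fun=> c) = 2 * `|c|.
Proof. by rewrite /L1 !Rintegral_probability_cst mulr_natl mulr2n. Qed.

Lemma L1Z (c : R) f :
  bounded_measurable f -> L1 (fun x => c * f x) = `|c| * L1 f.
Proof.
move=> /bounded_measurable_norm bf.
rewrite /L1 mulrDr -!RintegralZl//; last 2 first.
  exact: bounded_measurable_integrable.
  exact: bounded_measurable_integrable.
by congr (_ + _); apply: eq_Rintegral => x _; rewrite normrM.
Qed.

Lemma L1_indic (A : set T) :
  measurable A -> L1 \1_A = fine (mu A) + fine (nu A).
Proof.
move=> mA; rewrite /L1 -!Rintegral_probability_indic//.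
by congr (_ + _); apply: eq_Rintegral => x _; rewrite ger0_norm ?indicE.
Qed.

(** The linear term is 1-Lipschitz in L1([nu]). In the logarithmic term one factor [expR C] bounds
    the slope of exp on [-C, C], and another comes from dividing by an integral that is at least
    [expR (- C)]. *)
Lemma entropy_functional_le f g (C : R) :
  bounded_measurable f -> bounded_measurable g ->
  (forall x, `|f x| <= C) -> (forall x, `|g x| <= C) ->
  entropy_functional mu nu f <=
  entropy_functional mu nu g
    + (1 + expR (C + C)) * L1 (fun x => f x - g x).
Proof.
move=> bf bg fC gC.
have bfg := bounded_measurable_norm _ (bounded_measurableB _ _ bf bg).
have bef := bounded_measurable_expR _ bf.
have beg := bounded_measurable_expR _ bg.
have int := @bounded_measurable_integrable _ T R.
have ndiff : \int[nu]_x f x - \int[nu]_x g x <= \int[nu]_x `|f x - g x|.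
  rewrite -RintegralB//; [|exact: int..].
  apply: le_Rintegral => //; [|exact: int|by move=> x _; exact: ler_norm].
  exact/int/bounded_measurableB.
have mdiff : \int[mu]_x expR (g x) - \int[mu]_x expR (f x) <=
    expR C * \int[mu]_x `|f x - g x|.
  rewrite -RintegralB//; [|exact: int..].
  rewrite -RintegralZl//; last exact: int.
  apply: le_Rintegral => //.
  - exact/int/bounded_measurableB.
  - exact/int/bounded_measurableZ.
  - move=> x _; apply: le_trans (expR_sub_le _ _) _.
    rewrite distrC ler_wpM2r// ler_expR.
    exact: le_trans (ler_norm _) (gC _).
have lower (h : T -> R) : bounded_measurable h -> (forall x, `|h x| <= C) ->
    expR (- C) <= \int[mu]_x expR (h x).
  move=> bh hC; rewrite -[leLHS](Rintegral_probability_cst mu).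
  apply: le_Rintegral => //.
  - exact/int/bounded_measurable_cst.
  - exact/int/bounded_measurable_expR.
  - by move=> x _; rewrite ler_expR; have := hC x; rewrite ler_norml => /andP[].
have fpos : 0 < \int[mu]_x expR (f x).
  exact: lt_le_trans (expR_gt0 _) (lower _ bf fC).
have gpos : 0 < \int[mu]_x expR (g x).
  exact: lt_le_trans (expR_gt0 _) (lower _ bg gC).
have nuN0 : 0 <= \int[nu]_x `|f x - g x| by exact: Rintegral_ge0.
have muN0 : 0 <= \int[mu]_x `|f x - g x| by exact: Rintegral_ge0.
have lndiff : ln (\int[mu]_x expR (g x)) - ln (\int[mu]_x expR (f x)) <=
    expR (C + C) * \int[mu]_x `|f x - g x|.
  apply: le_trans (ln_sub_le _ _ gpos fpos) _.
  rewrite ler_pdivrMr//; apply: le_trans mdiff _.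
  (* It remains to bound [expR C] by [expR (C + C)] times the integral of [expR (f x)], which is the
     lower bound [expR (- C)] in disguise. *)
  rewrite mulrAC ler_wpM2r//.
  have -> : expR C = expR (C + C) * expR (- C) by rewrite -expRD addrK.
  by rewrite ler_wpM2l ?expR_ge0// lower.
have : 0 <= expR (C + C) * \int[nu]_x `|f x - g x|.
  by rewrite mulr_ge0 ?expR_ge0.
by rewrite /entropy_functional /L1; lra.
Qed.

End L1.

(** * Approximation by functions of the projections *)

Lemma sum_ltr_nat_bounds {R : realFieldType} (y : R) (K : nat) :
  0 <= y -> y <= K%:R ->
  y <= \sum_(k < K) (k%:R < y)%R%:R <= y + 1.
Proof.
(* The sum counts the naturals below [y], so it is the ceiling of [y]. In the induction step either
   the new term vanishes, or [K < y] and all [K + 1] terms equal 1. *)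
move=> y0; elim: K => [|K IH] yK; first by rewrite big_ord0 yK addr_ge0.
rewrite big_ord_recr/=; have [Ky|yK'] := ltP K%:R y; last first.
  by rewrite addr0 IH.
rewrite (eq_bigr (fun=> 1)) => [|k _].
  move: yK; rewrite sumr_const card_ord -natr1 /= mulr1n => yK.
  by apply/andP; split; lra.
by rewrite (le_lt_trans _ Ky)// ler_nat ltnW.
Qed.

Lemma bounded_measurable_sum {d} {T : measurableType d} {R : realType}
    (K : nat) (F : nat -> T -> R) :
  (forall k, bounded_measurable (F k)) ->
  bounded_measurable (fun x => \sum_(k < K) F k x).
Proof.
move=> bF; elim: K => [|K IH].
  by under eq_fun do rewrite big_ord0; exact: bounded_measurable_cst.
under eq_fun do rewrite big_ord_recr /=.
exact: bounded_measurableD.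
Qed.

Section tower.
Context {d} {T : measurableType d} {R : realType} (mu nu : probability T R).
Variable p : nat -> {mfun T >-> T}.
(** Each [p n] factors through every later [p m], so functions of projections at different levels
    can be combined at the larger level. *)
Hypothesis p_tower : forall n m x, (n <= m)%N -> p n (p m x) = p n x.
Implicit Types f g h : T -> R.
Local Notation L1 := (L1 mu nu).

(** No bound on [g] in terms of [f] is requested, which keeps the class easily closed under linear
    operations; clipping restores a bound when one is needed. *)
Definition approximable f : Prop := forall e : R, 0 < e ->
  exists n g, bounded_measurable g /\ L1 (fun x => f x - g (p n x)) < e.

Lemma approximable_comp n g :
  bounded_measurable g -> approximable (fun x => g (p n x)).
Proof.
move=> bg e e0; exists n, g; split => //.
by under eq_fun do rewrite subrr; rewrite L1_cst normr0 mulr0.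
Qed.

Lemma approximableD f g : bounded_measurable f -> bounded_measurable g ->
  approximable f -> approximable g -> approximable (fun x => f x + g x).
Proof.
move=> bf bg af ag e e0; have e20 : 0 < e / 2 by rewrite divr_gt0.
have [n [f' [bf' ff']]] := af _ e20.
have [m [g' [bg' gg']]] := ag _ e20.
exists (maxn n m), (fun x => f' (p n x) + g' (p m x)); split.
  by apply: bounded_measurableD; exact: bounded_measurable_comp.
under eq_fun do rewrite !p_tower ?leq_maxl ?leq_maxr//.
have bf'p := bounded_measurable_comp (p n) _ bf'.
have bg'p := bounded_measurable_comp (p m) _ bg'.
apply: le_lt_trans (_ : L1 (fun x => f x - f' (p n x)) +
  L1 (fun x => g x - g' (p m x)) < _); last by rewrite [ltRHS]splitr ltrD.
apply: L1_le => [||| x]; first by apply: bounded_measurableB;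
  exact: bounded_measurableD.
- exact: bounded_measurableB.
- exact: bounded_measurableB.
- by rewrite opprD addrACA ler_normD.
Qed.

Lemma approximableZ (c : R) f : bounded_measurable f ->
  approximable f -> approximable (fun x => c * f x).
Proof.
(* Dividing by [|c| + 1] rather than [|c|] covers [c = 0]. *)
move=> bf af e e0; have c0 : 0 < `|c| + 1 by rewrite ltr_wpDl.
have [n [g [bg fg]]] := af _ (divr_gt0 e0 c0).
exists n, (fun x => c * g x); split; first exact: bounded_measurableZ.
under eq_fun do rewrite -mulrBr.
have bgp := bounded_measurable_comp (p n) _ bg.
rewrite L1Z; last exact: bounded_measurableB.
move: fg; rewrite ltr_pdivlMr// mulrC; apply: le_lt_trans.
by rewrite ler_wpM2r ?lerDl// addr_ge0// Rintegral_ge0.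
Qed.

Lemma approximable_sum (K : nat) (F : nat -> T -> R) :
  (forall k, bounded_measurable (F k)) -> (forall k, approximable (F k)) ->
  approximable (fun x => \sum_(k < K) F k x).
Proof.
move=> bF aF; elim: K => [|K IH].
  under eq_fun do rewrite big_ord0.
  exact/(approximable_comp 0 (fun=> 0))/bounded_measurable_cst.
under eq_fun do rewrite big_ord_recr /=.
by apply: approximableD => //; exact: bounded_measurable_sum.
Qed.

Lemma approximable_closed f : bounded_measurable f ->
  (forall e : R, 0 < e -> exists g, [/\ bounded_measurable g, approximable g &
    L1 (fun x => f x - g x) < e]) -> approximable f.
Proof.
move=> bf H e e0; have e20 : 0 < e / 2 by rewrite divr_gt0.
have [g [bg ag fg]] := H _ e20.
have [n [h [bh gh]]] := ag _ e20.
exists n, h; split => //.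
have bhp := bounded_measurable_comp (p n) _ bh.
apply: le_lt_trans (_ : L1 (fun x => f x - g x) +
  L1 (fun x => g x - h (p n x)) < _); last by rewrite [ltRHS]splitr ltrD.
apply: L1_le => [||| x]; [exact: bounded_measurableB..|].
exact: ler_distD.
Qed.

Hypothesis p_generate : measurable `<=`
  <<s \bigcup_n [set p n @^-1` B | B in measurable] >>.

(** Dynkin's lemma: the preimages under the [p n] form a pi-system [G] generating all measurable
    sets, and the sets [H] with approximable indicator form a lambda-system containing [G]. *)
Lemma approximable_indic (A : set T) :
  measurable A -> approximable (\1_A : T -> R).
Proof.
pose G := \bigcup_n [set p n @^-1` B | B in @measurable _ T].
pose H : set (set T) := [set B | measurable B /\ approximable \1_B].
(* By the tower property, preimages at levels [n] and [m] are both preimages at level [maxn n m]. *)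
have GI : setI_closed G.
  move=> _ _ [n _ [B mB <-]] [m _ [C mC <-]]; exists (maxn n m) => //.
  exists (p n @^-1` B `&` p m @^-1` C).
    by apply: measurableI; rewrite -[X in measurable X]setTI;
      exact: measurable_funPT.
  by rewrite preimage_setI; congr (_ `&` _); apply/seteqP; split => x /=;
    rewrite p_tower ?leq_maxl ?leq_maxr.
have GH : G `<=` H.
  move=> _ [n _ [B mB <-]]; split.
    by rewrite -[X in measurable X]setTI; exact: measurable_funPT.
  exact: (approximable_comp n \1_B (bounded_measurable_indic _ mB)).
have lH : lambda_system setT H.
  split => //.
  - split => //; rewrite indicT.
    exact/(approximable_comp 0 (fun=> 1))/bounded_measurable_cst.
  - move=> B C CB [mB aB] [mC aC]; split; first exact: measurableD.
    have -> : \1_(B `\` C) = (fun x => \1_B x + (- 1) * \1_C x) :> (T -> R).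
      apply/funext => x; rewrite !indicE in_setD.
      have [xC|] := boolP (x \in C); last by rewrite mulr0 addr0 andbT.
      by rewrite (mem_set (CB x (set_mem xC))) mulr1 subrr.
    have bB := bounded_measurable_indic (R := R) _ mB.
    have bC := bounded_measurable_indic (R := R) _ mC.
    apply: approximableD => //; first exact: bounded_measurableZ.
    exact: approximableZ.
  - move=> F ndF HF; have mF k : measurable (F k) by case: (HF k).
    have mU : measurable (\bigcup_i F i) by exact: bigcup_measurable.
    split => //; apply: approximable_closed => [|e e0].
      exact: bounded_measurable_indic.
    (* Continuity from below, stated for an arbitrary measure so that it serves [mu] and [nu], each
       with error [e / 2]. *)
    have lim (P : probability T R) :
        \forall k \near \oo, fine (P (\bigcup_i F i `\` F k)) < e / 2.
      have := nondecreasing_cvg_mu (mu := P) mF mU ndF.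
      rewrite -[X in _ --> X]fineK ?fin_num_measure//.
      move=> /fine_cvgP[_ /cvgrPdist_lt/(_ (e / 2))].
      rewrite divr_gt0// => /(_ isT); apply: filterS => k.
      apply: le_lt_trans; rewrite /= -fineB ?fin_num_measure//.
      rewrite measureD//; last by rewrite ltey_eq fin_num_measure.
      rewrite setIidr ?ler_norm//.
      exact: bigcup_sup.
    near \oo => k.
    exists \1_(F k); split; [exact: bounded_measurable_indic|by case: (HF k)|].
    have -> : (fun x => \1_(\bigcup_i F i) x - \1_(F k) x) =
        \1_(\bigcup_i F i `\` F k) :> (T -> R).
      apply/funext => x; rewrite !indicE in_setD.
      have [xC|] := boolP (x \in F k); last by rewrite subr0 andbT.
      rewrite mem_set ?subrr//; exists k => //; exact: set_mem.
    rewrite L1_indic; last exact: measurableD.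
    by rewrite [ltRHS]splitr ltrD//; near: k; exact: lim.
move=> /p_generate mA.
by have [] := lambda_system_subset GI lH GH (fun X _ => @subsetT _ X) mA.
Unshelve. all: by end_near. Qed.

Lemma bounded_measurable_approximable f :
  bounded_measurable f -> approximable f.
Proof.
move=> bf; apply: approximable_closed => // e e0.
have [mf [C fC]] := bf.
have dlt0 : 0 < e / 3 by rewrite divr_gt0.
(* The staircase -C + (e/3) #{k < K | f > -C + k (e/3)} is within e/3 of f. *)
pose y x := (f x + C) / (e / 3).
(* Since [f <= C], [y] never exceeds [(C + C) / (e / 3)], so [K] steps reach the top of the
   range. *)
pose K := Num.bound ((C + C) / (e / 3)).
have bI k : bounded_measurable (\1_[set x | k%:R < y x] : T -> R).
  apply: bounded_measurable_indic.
  rewrite -[X in measurable X]setTI; apply: measurable_fun_ltr => //.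
  by apply: measurable_funM => //; exact: measurable_funD.
have bS := bounded_measurable_sum K _ bI.
have bC := bounded_measurable_cst (T := T) (- C).
have bg := bounded_measurableD _ _ (bounded_measurableZ (e / 3) _ bS) bC.
have aS : approximable (fun x => \sum_(k < K) \1_[set x | k%:R < y x] x).
  apply: (approximable_sum _ (fun k => \1_[set x | k%:R < y x])) => k //.
  apply: approximable_indic; exact/measurable_indicP/(bI k).1.
exists (fun x => e / 3 * (\sum_(k < K) \1_[set x | k%:R < y x] x) + - C).
split => //.
- apply: approximableD => //; first exact: bounded_measurableZ.
    exact: approximableZ.
  exact: (approximable_comp 0 (fun=> - C)).
(* A uniform error [e / 3] counts once for each measure, giving [2 e / 3 < e]. The zero function
   fills the second slot of [L1_le]. *)
- have lte : L1 (fun=> e / 3) + L1 (fun=> 0) < e.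
    by rewrite !L1_cst normr0 gtr0_norm//; lra.
  apply: le_lt_trans lte; apply: L1_le => [||| x]; [exact: bounded_measurableB|
    exact: bounded_measurable_cst..|].
  have := fC x; rewrite ler_norml => /andP[fC1 fC2].
  have y0 : 0 <= y x by apply: divr_ge0 (ltW dlt0); lra.
  have yK : y x <= K%:R.
    apply: le_trans (_ : (C + C) / (e / 3) <= _).
      by rewrite ler_pM2r ?invr_gt0// lerD2r.
    by apply/ltW/archi_boundP; apply: divr_ge0 (ltW dlt0); lra.
  have := sum_ltr_nat_bounds _ _ y0 yK.
  rewrite (eq_bigr (fun k : 'I_K => \1_[set x | k%:R < y x] x)); last first.
    move=> k _; rewrite indicE; congr ((nat_of_bool _)%:R).
    by apply/idP/idP; rewrite inE.
  set S := \sum_(k < K) _; move=> /andP[yS Sy].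
  have fE : f x = e / 3 * y x - C by rewrite /y mulrC divfK ?gt_eqF// addrK.
  rewrite fE normr0 addr0 (gtr0_norm dlt0) ler_norml.
  move: yS Sy; rewrite -(ler_pM2l dlt0) -(ler_pM2l dlt0 S); lra.
Qed.

(** Replacing [f] by a close function of some [p n] costs at most [e], and the new value is the
    functional of the pushforwards at level [n], hence at most their entropy. *)
Lemma relative_entropy_distribution_ge f : bounded_measurable f ->
  ((entropy_functional mu nu f)%:E <=
    ereal_sup (range (fun n =>
      relative_entropy (distribution nu (p n)) (distribution mu (p n)))))%E.
Proof.
move=> bf; have [mf [C fC]] := bf.
apply/lee_addgt0Pr => e e0.
have c0 : 0 < 1 + expR (C + C) by rewrite ltr_wpDr ?expR_ge0.
have [n [g [bg fg]]] := bounded_measurable_approximable _ bf _ (divr_gt0 e0 c0).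
have C0 : 0 <= C by exact: le_trans (normr_ge0 _) (fC point).
(* The Lipschitz constant depends on a common sup bound, which [g] may violate. Clipping to [-C, C]
   enforces it without increasing the distance to [f], whose values lie in that interval. *)
pose clip (z : R) : R := Num.max (- C) (Num.min C z).
have clipC z : `|clip z| <= C.
  by rewrite ler_norml /clip le_max lexx ge_max ge_min lexx/= andbT; lra.
have clip_dist a z : `|a| <= C -> `|a - clip z| <= `|a - z|.
  rewrite ler_norml => /andP[aC Ca]; rewrite /clip.
  have [zC|Cz] := leP C z; have [|] := leP (- C) _ => ?;
  have := ler_norm (a - z); have := ler_norm (z - a); rewrite (distrC z a);
  by rewrite ler_norml; lra.
have bcg : bounded_measurable (fun x => clip (g x)).
  split; last by exists C.
  by apply: measurable_maxr => //; apply: measurable_minr => //; case: bg.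
apply: le_trans (_ : (entropy_functional mu nu (fun x => clip (g (p n x))) +
   e)%:E <= _)%E.
  have bgp := bounded_measurable_comp (p n) _ bg.
  have bcgp := bounded_measurable_comp (p n) _ bcg.
  rewrite lee_fin; apply: le_trans (entropy_functional_le _ _ _ _ C _ _ _ _) _.
  - by [].
  - exact: bcgp.
  - by [].
  - by [].
  rewrite lerD2l mulrC -ler_pdivlMr//; apply: le_trans (ltW fg).
  rewrite -[leRHS]addr0 -[X in _ <= _ + X](_ : L1 (fun=> 0) = 0); last first.
    by rewrite L1_cst normr0 mulr0.
  apply: L1_le => [||| x].
  - exact: bounded_measurableB.
  - exact: bounded_measurableB.
  - exact: bounded_measurable_cst.
  - by rewrite normr0 addr0 clip_dist.
rewrite EFinD leeD2r//; apply: le_trans (ereal_sup_ubound _); last first.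
  by exists n.
apply: ereal_sup_ubound; exists (fun x => clip (g x)).
  exact/bounded_measurableP.
rewrite /entropy_functional !Rintegral_distribution//.
exact: bounded_measurable_expR.
Qed.

End tower.

(** * Relative entropy: test-function bounds and pushforwards *)

Section relative_entropy_bounds.
Context {d} {T : measurableType d} {R : realType} (mu nu : probability T R).
Implicit Types f g : T -> R.

Lemma relative_entropy_ubound f : bounded_measurable f ->
  ((entropy_functional mu nu f)%:E <= relative_entropy nu mu)%E.
Proof.
move=> bf; apply: ereal_sup_ubound; exists f => //.
exact/bounded_measurableP.
Qed.

Lemma relative_entropy_le (x : \bar R) :
  (forall f, bounded_measurable f ->
    ((entropy_functional mu nu f)%:E <= x)%E) ->
  (relative_entropy nu mu <= x)%E.
Proof.
by move=> H; apply/ereal_supP => _ [f /bounded_measurableP bf <-]; exact: H.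
Qed.

End relative_entropy_bounds.

Section pushforward_entropy.
Context {d} {T : measurableType d} {R : realType} (mu nu : probability T R).
Implicit Types f g : T -> R.

Lemma entropy_functional_distribution (p : {mfun T >-> T}) f :
  bounded_measurable f ->
  entropy_functional (distribution mu p) (distribution nu p) f =
  entropy_functional mu nu (fun x => f (p x)).
Proof.
move=> bf; rewrite /entropy_functional !Rintegral_distribution//.
exact: bounded_measurable_expR.
Qed.

Lemma relative_entropy_ge0 : (0 <= relative_entropy nu mu)%E.
Proof.
apply: le_trans (relative_entropy_ubound mu nu _ (bounded_measurable_cst 0)).
by rewrite /entropy_functional !Rintegral_probability_cst expR0 ln1 subrr.
Qed.

(** Test with [t * \1_A]. The exponential integrates to [1 + (expR t - 1) * mu A]; dropping the
    [- 1] only enlarges the logarithm. *)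
Lemma relative_entropy_set (A : set T) (t : R) : measurable A -> 0 <= t ->
  ((t * fine (nu A) - ln (1 + expR t * fine (mu A)))%:E <=
   relative_entropy nu mu)%E.
Proof.
move=> mA t0; have bA := bounded_measurable_indic (R := R) _ mA.
have btA := bounded_measurableZ t _ bA.
apply: le_trans (relative_entropy_ubound mu nu _ btA).
have int := @bounded_measurable_integrable _ T R.
have fA0 (P : probability T R) : 0 <= fine (P A) by exact: fine_ge0.
rewrite /entropy_functional.
have -> : \int[mu]_x expR (t * \1_A x) = 1 + (expR t - 1) * fine (mu A).
  transitivity (\int[mu]_x (1 + (expR t - 1) * \1_A x)).
    apply: eq_Rintegral => x _; rewrite indicE.
    by case: (x \in A); rewrite ?mulr1 ?mulr0 ?expR0 ?addr0// subrKC.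
  rewrite RintegralD//.
  - rewrite Rintegral_probability_cst RintegralZl//; last exact: int.
    by rewrite Rintegral_probability_indic.
  - exact/int/bounded_measurable_cst.
  - exact/int/bounded_measurableZ.
rewrite RintegralZl//; last exact: int.
rewrite Rintegral_probability_indic// lee_fin lerD2l lerN2.
have et1 : 1 <= expR t by rewrite -[leLHS]expR0 ler_expR.
rewrite ler_ln ?posrE.
- by rewrite lerD2l ler_wpM2r// gerBl.
- by rewrite ltr_pwDl// mulr_ge0// subr_ge0.
- by rewrite ltr_pwDl// mulr_ge0// expR_ge0.
Qed.

Lemma relative_entropy_distribution_le (p : {mfun T >-> T}) :
  (relative_entropy (distribution nu p) (distribution mu p) <=
   relative_entropy nu mu)%E.
Proof.
apply: relative_entropy_le => f bf; rewrite entropy_functional_distribution//.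
exact/relative_entropy_ubound/bounded_measurable_comp.
Qed.

Section tower.
Variable p : nat -> {mfun T >-> T}.
Hypothesis p_tower : forall n m x, (n <= m)%N -> p n (p m x) = p n x.

Let h n : \bar R :=
  relative_entropy (distribution nu (p n)) (distribution mu (p n)).

Lemma relative_entropy_distribution_nondecreasing :
  {homo h : n m / (n <= m)%N >-> (n <= m)%E}.
Proof.
move=> n m nm; apply: relative_entropy_le => f bf.
(* The test function [f] at level [n] corresponds to [f] composed with [p n] at level [m]: both pull
   back to the same function by the tower property. *)
have bfp := bounded_measurable_comp (p n) _ bf.
apply: le_trans (relative_entropy_ubound _ _ _ bfp).
rewrite !entropy_functional_distribution//.
by under [X in (_ <= (_ X)%:E)%E]eq_fun do rewrite p_tower//.
Qed.

Hypothesis p_generate : measurable `<=`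
  <<s \bigcup_n [set p n @^-1` B | B in measurable] >>.

Lemma ereal_sup_relative_entropy_distribution :
  ereal_sup (range h) = relative_entropy nu mu.
Proof.
apply/eqP; rewrite eq_le; apply/andP; split.
  by apply/ereal_supP => _ [n _ <-]; exact: relative_entropy_distribution_le.
by apply: relative_entropy_le => f bf;
  exact: relative_entropy_distribution_ge.
Qed.

Lemma cvg_relative_entropy_distribution :
  h @ \oo --> relative_entropy nu mu.
Proof.
rewrite -ereal_sup_relative_entropy_distribution.
exact/ereal_nondecreasing_cvgn/relative_entropy_distribution_nondecreasing.
Qed.

End tower.
End pushforward_entropy.

(** * Tagged partitions: tower property, generation and the metric estimate *)

Section discretization.
Context {R : realType} {M : completeMetricType R}
  {mu : probability (borel M) R} (P : tagged_partitions mu).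

Lemma tp_block_ex n x : exists i, tp_block P n i x.
Proof.
have [cov _ _] := tp_block_partition P n.
have [i _ ix] : cover setT (tp_block P n) x by rewrite cov.
by exists i.
Qed.

Lemma tp_block_nested n m (j : 'I_(tp_len P m)) : (n <= m)%N ->
  exists i : 'I_(tp_len P n), tp_block P m j `<=` tp_block P n i.
Proof.
elim: m j => [|m IH] j; first by rewrite leqn0 => /eqP ->; exists j.
rewrite leq_eqVlt ltnS => /predU1P[->|/IH {}IH]; first by exists j.
have [k jk] := tp_block_refine mu P m j.
by have [i ki] := IH k; exists i; exact: subset_trans ki.
Qed.

Lemma tp_proj_in n i x : tp_block P n i x -> tp_block P n i (tp_proj P n x).
Proof. by move=> ix; rewrite (tp_projE ix); exact: tp_tag_in. Qed.

(** A point and its level-[m] tag share a block of level [m], hence the coarser block of level [n]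
    containing it. *)
Lemma tp_proj_tower n m x :
  (n <= m)%N -> tp_proj P n (tp_proj P m x) = tp_proj P n x.
Proof.
move=> nm; have [j jx] := tp_block_ex m x.
have [i ji] := tp_block_nested n m j nm.
by rewrite (tp_projE (ji _ (tp_proj_in _ _ _ jx))) (tp_projE (ji _ jx)).
Qed.

Lemma tp_block_preimage n i : tp_proj P n @^-1` tp_block P n i = tp_block P n i.
Proof.
apply/seteqP; split => [x /= ix|x]; last exact: tp_proj_in.
have [j jx] := tp_block_ex n x; have := tp_proj_in _ _ _ jx.
have [_ tI _] := tp_block_partition P n.
by move=> jx'; rewrite (tI i j)//; exists (tp_proj P n x).
Qed.

(** Each block is its own preimage under the projection of its level, so the preimages include the
    blocks, which already generate the Borel sets. *)
Lemma tp_proj_generate : @measurable _ (borel M) `<=`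
  <<s \bigcup_n [set tp_proj P n @^-1` B | B in @measurable _ (borel M)] >>.
Proof.
rewrite -[X in X `<=` _](tp_block_generate mu P); apply: sub_sigma_algebra2.
move=> _ [n _ [i _ <-]]; exists n => //; exists (tp_block P n i).
  exact: tp_block_measurable.
exact: tp_block_preimage.
Qed.

Lemma measurable_tp_K_compl n : measurable (~` tp_K P n : set (borel M)).
Proof.
rewrite (tp_block_large mu P n); apply: fin_bigcup_measurable => // i _.
exact: tp_block_measurable.
Qed.

Lemma tp_proj_close n x : tp_K P n x -> mdist (tp_proj P n x) x <= n.+1%:R^-1.
Proof.
move=> Kx; have [i ix] := tp_block_ex n x.
have [ismall|ilarge] := ltnP i (tp_len_small P n); last first.
  have : (~` tp_K P n) x by rewrite (tp_block_large mu P n); exists i.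
  by move/(_ Kx).
rewrite -lee_fin; apply: le_trans (ltW (tp_block_diam mu P n i ismall)).
apply: ereal_sup_ubound; exists (tp_proj P n x, x) => //; split => //=.
exact: tp_proj_in.
Qed.

Lemma tp_K_compl_entropy (nu : probability (borel M) R) (n : nat) (S : R) :
  relative_entropy nu mu = S%:E ->
  fine (nu (~` tp_K P n)) <= (S + ln 2) / n.+1%:R.
Proof.
move=> HS; have n0 : 0 < n.+1%:R :> R by [].
have := relative_entropy_set mu nu _ n.+1%:R (measurable_tp_K_compl n) (ltW n0).
rewrite HS lee_fin => nuS.
rewrite ler_pdivlMr// mulrC.
(* With m = [n.+1], the assumed bound is at most [expR (- m)] because m <= m^2 and 1 <= m. *)
have muK : fine (mu (~` tp_K P n)) <= expR (- n.+1%:R).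
  rewrite -lee_fin fineK ?fin_num_measure//; last exact: measurable_tp_K_compl.
  apply: le_trans (tp_K_measure mu P n) _; rewrite lee_fin ler_pdivrMr//.
  apply: le_trans (_ : expR (- n.+1%:R) * 1 <= _); last first.
    by rewrite ler_wpM2l ?expR_ge0// ler1n.
  rewrite mulr1 ler_expR.
  have : (n.+1%:R : R) <= n.+1%:R ^+ 2 by rewrite ler_eXnr// ler1n.
  by lra.
have : ln (1 + expR n.+1%:R * fine (mu (~` tp_K P n))) <= ln 2.
  rewrite ler_ln ?posrE//; last first.
    by rewrite ltr_pwDl// mulr_ge0 ?expR_ge0// fine_ge0.
  rewrite -[leRHS]/(1 + 1) lerD2l -[leRHS]expR0 -(subrr n.+1%:R) expRD.
  by rewrite ler_wpM2l// expR_ge0.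
lra.
Qed.

(** The preimage of a ray above [a] is open: around [x] it contains the ball of radius [f x - a]. *)
Lemma lipschitz_measurable (f : M -> R) :
  (forall x y, `|f x - f y| <= mdist x y) ->
  measurable_fun setT (f : borel M -> R).
Proof.
move=> fL; apply: (measurability _ (RGenOInfty.measurableE R)).
move=> _ [_ [a ->]] <-; rewrite setTI; apply: sub_sigma_algebra.
rewrite openE => x /=; rewrite in_itv/= andbT => ax.
apply/nbhs_ballP; exists (f x - a); first by rewrite /= subr_gt0.
move=> y; rewrite -metricType_numDomainType.ball_mdistE /= => xy.
rewrite in_itv/= andbT; have := ler_norm (f x - f y); have := fL x y.
by lra.
Qed.

(** Compare [f] with its composition with the projection pointwise: on [tp_K P n] the Lipschitz
    bound gives at most [n.+1%:R^-1], and off it [|f| <= 1] gives at most 2. *)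
Lemma bounded_lipschitz_dist_discretize (nu : probability (borel M) R) n :
  (bounded_lipschitz_dist (discretize P n nu) nu <=
   (n.+1%:R^-1 + 2 * fine (nu (~` tp_K P n)))%:E)%E.
Proof.
apply/ereal_supP => _ [f [fL f1] <-].
have mK := measurable_tp_K_compl n.
have bf : bounded_measurable (f : borel M -> R).
  by split; [exact: lipschitz_measurable|exists 1].
have bfp := bounded_measurable_comp (tp_proj P n) _ bf.
have int := @bounded_measurable_integrable _ _ _ nu.
have bI := bounded_measurableZ 2 _ (bounded_measurable_indic (R := R) _ mK).
have bc := bounded_measurable_cst (T := borel M) (n.+1%:R^-1 : R).
rewrite lee_fin distrC [X in `|X - _|]Rintegral_distribution//.
rewrite -RintegralB//; [|exact: int..].
apply: le_trans (le_normr_Rintegral _ _) _ => //.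
  exact/int/bounded_measurableB.
have -> : n.+1%:R^-1 + 2 * fine (nu (~` tp_K P n)) =
    \int[nu]_x (n.+1%:R^-1 + 2 * \1_(~` tp_K P n) x).
  rewrite RintegralD//; [|exact: int..].
  rewrite Rintegral_probability_cst RintegralZl//.
    by rewrite Rintegral_probability_indic.
  exact/int/bounded_measurable_indic.
apply: le_Rintegral => //.
- exact/int/bounded_measurable_norm/bounded_measurableB.
- exact/int/bounded_measurableD.
- move=> x _; rewrite indicE in_setC; have [xK|xK] /= := boolP (x \in tp_K P n).
    rewrite mulr0 addr0; apply: le_trans (fL _ _) _.
    exact/tp_proj_close/set_mem.
  rewrite mulr1; apply: le_trans (ler_normB _ _) _.
  apply: le_trans (lerD (f1 _) (f1 _)) _.
  by rewrite -[2]/(1 + 1) lerDr.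
Qed.

End discretization.

Theorem lemma4p1 (R : realType) (M : completeMetricType R)
    (sepM : separable M) (mu nu : probability (borel M) R)
    (P : tagged_partitions mu) :
  let h : nat -> \bar R :=
    fun n => relative_entropy (discretize P n nu) (discretize P n mu) in
  [/\ ereal_sup (range h) = relative_entropy nu mu,
      h @ \oo --> relative_entropy nu mu
    & (ereal_sup (range h) < +oo)%E ->
      exists2 c : R, 0 <= c &
        forall n, (bounded_lipschitz_dist (discretize P n nu) nu
                   <= (c / n.+1%:R)%:E)%E].
Proof.
move=> h.
have suph : ereal_sup (range h) = relative_entropy nu mu :=
  ereal_sup_relative_entropy_distribution mu nu _
    (tp_proj_tower P) (tp_proj_generate P).
split => //.
  exact: (cvg_relative_entropy_distribution mu nu _
    (tp_proj_tower P) (tp_proj_generate P)).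
rewrite suph => Hoo; have H0 := relative_entropy_ge0 mu nu.
have HS : relative_entropy nu mu = (fine (relative_entropy nu mu))%:E.
  by rewrite fineK// ge0_fin_numE.
have S0 := fine_ge0 H0; have ln20 : 0 <= ln 2 :> R by rewrite ln_ge0// ler1n.
(* The 1 accounts for the displacement on the compact set, and the rest for twice the mass outside
   it, bounded by (H + ln 2)/m where H is the finite entropy and m = [n.+1]. *)
exists (1 + 2 * (fine (relative_entropy nu mu) + ln 2)); first by lra.
move=> n; apply: le_trans (bounded_lipschitz_dist_discretize P nu n) _.
rewrite lee_fin [leRHS]mulrDl mul1r lerD2l -mulrA ler_wpM2l//.
exact: tp_K_compl_entropy.
Qed.
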